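(* Let $n\ge 3$ and let $f,g$ be $L^1$ functions on $S^{n-1}$ such that for almost every $u\in S^{n-1}$ one has: either $f(x)=g(x)$ for almost every $x\in S^{n-1}\cap u^{\perp}$, or $f(x)=g(-x)$ for almost every $x\in S^{n-1}\cap u^{\perp}$. Then $f(x)=g(x)$ for almost every $x\in S^{n-1}$, or $f(x)=g(-x)$ for almost every $x\in S^{n-1}$.
   Context: $S^{n-1}$ is the unit sphere of $\mathbb{R}^n$ and $u^\perp=\{x\in\mathbb{R}^n:\langle x,u\rangle=0\}$. ''Almost every'' refers to the usual volume (rotation-invariant) measure on $S^{n-1}$ and on the equators $S^{n-1}\cap u^\perp$ respectively. Functions are real-valued. *)

(* Defs.v *)
From HB Require Import structures.
From mathcomp Require Import all_boot all_order all_algebra.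
From mathcomp Require Import all_classical all_reals all_analysis.

Set Implicit Arguments.
Unset Strict Implicit.
Unset Printing Implicit Defensive.

Import Order.TTheory GRing.Theory Num.Theory.

Local Open Scope classical_set_scope.
Local Open Scope ring_scope.

Definition measure_rV_display : measure_display -> measure_display.
Proof. exact. Qed.

Section measurable_rV.
Context {d} {T : sigmaRingType d}.
Variable n : nat.

Let coord : 'I_n -> 'rV[T]_n -> T := fun i x => x ord0 i.

Let rV_set0 : g_sigma_preimage coord set0.
Proof. exact: sigma_algebra0. Qed.

Let rV_setC A : g_sigma_preimage coord A -> g_sigma_preimage coord (~` A).
Proof. exact: sigma_algebraC. Qed.

Let rV_bigcup (F : (set 'rV[T]_n)^nat) :
  (forall i, g_sigma_preimage coord (F i)) ->
  g_sigma_preimage coord (\bigcup_i (F i)).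
Proof. exact: sigma_algebra_bigcup. Qed.

(* The sigma-algebra generated by the coordinates, as for n.-tuple T; for T = R
   it is the Borel sigma-algebra of R^n. *)
HB.instance Definition _ := @isMeasurable.Build (measure_rV_display d)
  'rV[T]_n (g_sigma_preimage coord) rV_set0 rV_setC rV_bigcup.

End measurable_rV.

Section sphere.
Context {R : realType}.

Definition cons_rV n (p : R * 'rV[R]_n) : 'rV[R]_n.+1 := row_mx p.1%:M p.2.

Fixpoint lebesgue_rV n : set 'rV[R]_n -> \bar R :=
  if n is n'.+1 then
    pushforward (lebesgue_measure \x @lebesgue_rV n')%E (@cons_rV n')
  else \d_(0 : 'rV[R]_0).

Definition dot n (x y : 'rV[R]_n) : R := \sum_(i < n) x ord0 i * y ord0 i.

(* The library's norm on 'rV[R]_n is the sup norm. *)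
Definition enorm n (x : 'rV[R]_n) : R := Num.sqrt (dot x x).

Definition sphere n : set 'rV[R]_n := [set x | enorm x = 1].

Definition equator n (u : 'rV[R]_n) : set 'rV[R]_n :=
  [set x | enorm x = 1 /\ dot x u = 0].

(* Surface measure of the unit sphere of a k-dimensional Euclidean space with
   Lebesgue measure mu, by integration in polar coordinates: A has area k times
   the volume of the cone { t x | x in A, 0 < t <= 1 }. *)
Definition polar_measure n (k : nat) (mu : set 'rV[R]_n -> \bar R)
    (A : set 'rV[R]_n) : \bar R :=
  (k%:R%:E * mu [set x | (0 < enorm x <= 1)%R /\ A ((enorm x)^-1 *: x)])%E.

Definition sphere_measure n : set 'rV[R]_n -> \bar R :=
  polar_measure n (@lebesgue_rV n).

(* For |u| = 1, the (n-1)-dimensional Lebesgue measure of u^\perp (extended by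
   0 to R^n): the volume of A in u^\perp is that of the right cylinder
   { x + s u | x in A, 0 <= s <= 1 } of height 1 over A. *)
Definition hyperplane_measure n (u : 'rV[R]_n) (A : set 'rV[R]_n) : \bar R :=
  lebesgue_rV [set x | (0 <= dot x u <= 1)%R /\ A (x - dot x u *: u)].

Definition equator_measure n (u : 'rV[R]_n) : set 'rV[R]_n -> \bar R :=
  polar_measure n.-1 (hyperplane_measure u).

(* Only the values on the sphere matter. Integrability for the completion of
   the surface measure: f is a.e. equal to a Borel integrable function. *)
Definition L1_sphere n (f : 'rV[R]_n -> R) : Prop :=
  exists2 f0 : 'rV[R]_n -> R,
    (@sphere_measure n).-integrable (@sphere n) (EFin \o f0) &
    {ae @sphere_measure n, forall x, sphere x -> f x = f0 x}.

End sphere.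

(* Main.v *)
Require Import Defs.
From mathcomp Require Import all_boot all_order all_algebra.
From mathcomp Require Import all_classical all_reals all_analysis.
From HB Require Import structures.
From mathcomp Require Import measurable_realfun ring lra.

Import Order.TTheory GRing.Theory Num.Theory.
Local Open Scope classical_set_scope.
Local Open Scope ring_scope.

Set Implicit Arguments.
Unset Strict Implicit.
Unset Printing Implicit Defensive.

(** Let P = {f <> g} and Q = {f <> g o (-)}, as subsets of the sphere. For almost
    every hyperplane H through the origin, P or Q is null in H, so P x Q is null
    in H x H. Since n >= 3, almost every pair (x, y) lies on a common hyperplane,
    so integrating over H and exchanging the integrals shows that P x Q is null;
    hence P or Q is null.

    P and Q are replaced by the cones over them, and H by the graph
    x_1 = <w, x'>, with w in R^(n-1). For fixed x' and y', the map
    w |-> (<w, x'>, <w, y'>) is onto R^2 as soon as x' and y' are linearly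
    independent, so Tonelli's theorem and one-dimensional affine substitutions
    suffice. *)

(** * Null sets of product measures *)

Lemma measurable_preimageT d1 d2 (T1 : sigmaRingType d1) (T2 : sigmaRingType d2)
    (f : T1 -> T2) (A : set T2) :
  measurable [set: T1] -> measurable_fun setT f -> measurable A ->
  measurable (f @^-1` A).
Proof. by move=> mT mf mA; rewrite -[X in measurable X]setTI; exact: mf. Qed.

Lemma ae_notP d (T : measurableType d) (R : realType)
    (m : {measure set T -> \bar R}) (A : set T) :
  measurable A -> m A = 0%E <-> {ae m, forall x, ~ A x}.
Proof.
move=> mA; rewrite -negligibleP//.
by split; apply: negligibleS => x /= Ax; [exact: contrapT|exact].
Qed.

Section tonelli_null.
Context d1 d2 (T1 : measurableType d1) (T2 : measurableType d2) (R : realType).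
Context (m1 : {sigma_finite_measure set T1 -> \bar R}).
Context (m2 : {sigma_finite_measure set T2 -> \bar R}).
Context (E : set (T1 * T2)) (mE : measurable E).

(** The product measure of [E] is the integral of the measures of its sections, and a nonnegative
    function has integral zero exactly when it vanishes almost everywhere. *)
Lemma product_measure1_eq0P : (m1 \x m2)%E E = 0%E <->
  {ae m1, forall x, {ae m2, forall y, ~ E (x, y)}}.
Proof.
have -> : ((m1 \x m2) E = \int[m1]_(x in setT) `|(m2 \o xsection E) x|)%E.
  by apply: eq_integral => x _; rewrite gee0_abs.
rewrite ae_eq_integral_abs//; last exact: measurable_fun_xsection.
split; apply: filterS => x /= h.
  have {h} := h I; rewrite ae_notP; last exact: measurable_xsection.
  by apply: filterS => y; rewrite /xsection/= inE.
move=> _; apply/ae_notP; first exact: measurable_xsection.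
by move: h; apply: filterS => y; rewrite /xsection/= inE.
Qed.

Lemma product_measure2_eq0P : (m1 \x^ m2)%E E = 0%E <->
  {ae m2, forall y, {ae m1, forall x, ~ E (x, y)}}.
Proof.
have -> : ((m1 \x^ m2) E = \int[m2]_(x in setT) `|(m1 \o ysection E) x|)%E.
  by apply: eq_integral => x _; rewrite gee0_abs.
rewrite ae_eq_integral_abs//; last exact: measurable_fun_ysection.
split; apply: filterS => x /= h.
  have {h} := h I; rewrite ae_notP; last exact: measurable_ysection.
  by apply: filterS => y; rewrite /ysection/= inE.
move=> _; apply/ae_notP; first exact: measurable_ysection.
by move: h; apply: filterS => y; rewrite /ysection/= inE.
Qed.

(** The two iterated product measures agree on rectangles, hence on [E] by uniqueness. This is the
    form in which Tonelli's theorem is used below. *)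
Lemma ae_swap : {ae m1, forall x, {ae m2, forall y, ~ E (x, y)}} ->
  {ae m2, forall y, {ae m1, forall x, ~ E (x, y)}}.
Proof.
rewrite -product_measure1_eq0P -product_measure2_eq0P.
rewrite (@product_measure_unique _ _ _ _ _ m1 m2 (m1 \x^ m2)%E)//.
by move=> A B mA mB; exact: product_measure2E.
Qed.

End tonelli_null.

(** * Lebesgue measure on row vectors *)

Section lebesgue_rV_measure.
Context {R : realType}.
Local Notation RR := (measurableTypeR R).

Lemma measurable_coord n (i : 'I_n) :
  measurable_fun setT (fun x : 'rV[R]_n => x ord0 i).
Proof.
move=> _ Y mY; rewrite setTI; apply: sub_sigma_algebra => /=.
rewrite -bigcup_seq/=; exists i => /=; first by rewrite mem_index_enum.
by exists Y => //; rewrite setTI.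
Qed.

(** The sets with measurable preimage under [f] form a sigma-algebra; it contains the coordinate
    preimages, which generate the one on row vectors. *)
Lemma measurable_fun_rVP d (T : measurableType d) n (f : T -> 'rV[R]_n) :
  measurable_fun setT f <->
  forall i, measurable_fun setT (fun t => f t ord0 i).
Proof.
split=> [mf i|mf].
  exact: (measurableT_comp (measurable_coord i)).
move=> _ A; apply: (@smallest_sub _ _ _ (image_set_system setT f measurable)).
  by apply: sigma_algebra_image; exact: sigma_algebra_measurable.
rewrite -bigcup_seq; apply: bigcup_sub => i _ _ [C mC <-].
rewrite /image_set_system/= !setTI.
by have := mf i measurableT C mC; rewrite setTI.
Qed.

Lemma cons_rV_E0 n (p : R * 'rV[R]_n) i : cons_rV p i ord0 = p.1.
Proof.
rewrite /cons_rV; have -> : ord0 = lshift n (ord0 : 'I_1) by apply/val_inj.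
by rewrite (@row_mxEl _ 1 1 n) (ord1 i) mxE.
Qed.

Lemma cons_rV_ES n (p : R * 'rV[R]_n) i j :
  cons_rV p i (lift ord0 j) = p.2 ord0 j.
Proof.
rewrite /cons_rV; have -> : lift ord0 j = rshift 1 j by apply/val_inj.
by rewrite (@row_mxEr _ 1 1 n) (ord1 i).
Qed.

Definition uncons_rV n (x : 'rV[R]_n.+1) : R * 'rV[R]_n :=
  (x ord0 ord0, \row_j x ord0 (lift ord0 j)).

Lemma uncons_rVK n : cancel (@uncons_rV n) (@cons_rV R n).
Proof.
move=> x; apply/rowP => j; case: (unliftP ord0 j) => [k|] ->.
  by rewrite cons_rV_ES mxE.
by rewrite cons_rV_E0.
Qed.

Lemma cons_rVK n : cancel (@cons_rV R n) (@uncons_rV n).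
Proof.
move=> [t x]; rewrite /uncons_rV cons_rV_E0; congr pair.
by apply/rowP => j; rewrite mxE cons_rV_ES.
Qed.

Lemma measurable_fun_cons_rV d (T : measurableType d) n (f : T -> R)
    (g : T -> 'rV[R]_n) :
  measurable_fun setT f -> measurable_fun setT g ->
  measurable_fun setT (fun t => cons_rV (f t, g t)).
Proof.
move=> mf mg; apply/measurable_fun_rVP => i.
case: (unliftP ord0 i) => [k|] ->.
  under eq_fun do rewrite cons_rV_ES/=.
  by move/measurable_fun_rVP : mg; apply.
by under eq_fun do rewrite cons_rV_E0/=.
Qed.

Lemma measurable_cons_rV n : measurable_fun setT (@cons_rV R n : RR * _ -> _).
Proof.
rewrite (_ : cons_rV (n := n) = fun p => cons_rV (p.1, p.2)); last first.
  by apply/funext => -[].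
apply: measurable_fun_cons_rV; [exact: measurable_fst|exact: measurable_snd].
Qed.

Lemma measurable_uncons_rV n :
  measurable_fun setT (@uncons_rV n : _ -> RR * 'rV[R]_n).
Proof.
apply: measurable_fun_pair; first exact: measurable_coord.
apply/measurable_fun_rVP => i; under eq_fun do rewrite mxE.
exact: measurable_coord.
Qed.

(* The successor case of lebesgue_rV over an arbitrary measure m, so that the
   measure structures can be built by induction on the dimension. *)
Section lebesgue_rVS.
Context n (m : {sigma_finite_measure set 'rV[R]_n -> \bar R}).

Definition lebesgue_rVS : set 'rV[R]_n.+1 -> \bar R :=
  pushforward (@lebesgue_measure R \x m)%E (@cons_rV R n).

Let lebesgue_rVS0 : lebesgue_rVS set0 = 0%E.
Proof. by rewrite /lebesgue_rVS /pushforward preimage_set0 measure0. Qed.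

Let lebesgue_rVS_ge0 A : (0 <= lebesgue_rVS A)%E.
Proof. by rewrite /lebesgue_rVS; exact: (measure_ge0 (lebesgue_measure \x m)%E). Qed.

Let lebesgue_rVS_sigma_additive : semi_sigma_additive lebesgue_rVS.
Proof.
move=> F mF tF mUF.
apply: (@measure_semi_sigma_additive _ _ _ (pushforward _ _)) => //.
exact: measurable_cons_rV.
Qed.

HB.instance Definition _ := isMeasure.Build _ _ _ lebesgue_rVS
  lebesgue_rVS0 lebesgue_rVS_ge0 lebesgue_rVS_sigma_additive.

Let lebesgue_rVS_sigma_finite : sigma_finite setT lebesgue_rVS.
Proof.
have /sigma_finiteP[F [TF ndF Foo]] := sigma_finiteT (@lebesgue_measure R).
have /sigma_finiteP[G [TG ndG Goo]] := sigma_finiteT m.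
exists (fun k => @uncons_rV n @^-1` (F k `*` G k)).
  apply/esym; rewrite -preimage_bigcup -subTset => x _ /=.
  have [k _ Fk] : (\bigcup_k F k) (uncons_rV x).1 by rewrite -TF.
  have [l _ Gl] : (\bigcup_k G k) (uncons_rV x).2 by rewrite -TG.
  (* Both exhaustions are nondecreasing, so the larger index serves both factors. *)
  exists (maxn k l) => //; split.
  - by move: Fk; apply/subsetPset/ndF; exact: leq_maxl.
  - by move: Gl; apply/subsetPset/ndG; exact: leq_maxr.
move=> k; have [mF Fk] := Foo k; have [mG Gk] := Goo k; split.
  apply: measurable_preimageT => //; first exact: measurable_uncons_rV.
  exact: measurableX.
rewrite /lebesgue_rVS /pushforward -comp_preimage (_ : _ \o _ = id); last first.
  by apply/funext => p; exact: cons_rVK.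
by rewrite preimage_id product_measure1E// lte_mul_pinfty// ge0_fin_numE.
Qed.

HB.instance Definition _ := Measure_isSigmaFinite.Build _ _ _ lebesgue_rVS
  lebesgue_rVS_sigma_finite.

End lebesgue_rVS.

(** The recursion defines only a bare set function, and its successor case makes sense as a measure
    once the previous one is known to be sigma-finite; the induction therefore carries the whole
    structure along. *)
Lemma lebesgue_rV_structure n :
  exists m : {sigma_finite_measure set 'rV[R]_n -> \bar R},
    m = @lebesgue_rV R n :> (set _ -> \bar R).
Proof.
elim: n => [|n [m IH]].
  by exists [the {sigma_finite_measure set _ -> \bar R} of (\d_(0 : 'rV[R]_0))].
exists [the {sigma_finite_measure set _ -> \bar R} of lebesgue_rVS m].
by rewrite /= -IH.
Qed.

Let lebesgue_rV0 n : @lebesgue_rV R n set0 = 0%E.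
Proof. by have [m <-] := lebesgue_rV_structure n; rewrite ?measure0. Qed.

Let lebesgue_rV_ge0 n A : (0 <= @lebesgue_rV R n A)%E.
Proof. by have [m <-] := lebesgue_rV_structure n; rewrite ?measure0. Qed.

Let lebesgue_rV_sigma_additive n : semi_sigma_additive (@lebesgue_rV R n).
Proof.
have [m <-] := lebesgue_rV_structure n; exact: measure_semi_sigma_additive.
Qed.

HB.instance Definition _ n := isMeasure.Build _ _ _ (@lebesgue_rV R n)
  (lebesgue_rV0 n) (@lebesgue_rV_ge0 n) (@lebesgue_rV_sigma_additive n).

Let lebesgue_rV_sigma_finite n : sigma_finite setT (@lebesgue_rV R n).
Proof. have [m <-] := lebesgue_rV_structure n; exact: sigma_finiteT. Qed.

HB.instance Definition _ n := Measure_isSigmaFinite.Build _ _ _ (@lebesgue_rV R n)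
  (lebesgue_rV_sigma_finite n).

Lemma ae_lebesgue_rVS n (A : set 'rV[R]_n.+1) : measurable A ->
  {ae @lebesgue_rV R n.+1, forall x, ~ A x} <->
  {ae @lebesgue_measure R, forall t, {ae @lebesgue_rV R n,
    forall x, ~ A (cons_rV (t, x))}}.
Proof.
move=> mA; rewrite -ae_notP//= /pushforward product_measure1_eq0P//.
by apply: measurable_preimageT => //; exact: measurable_cons_rV.
Qed.

End lebesgue_rV_measure.

(** * Affine substitutions and measurability of vector operations *)

Section affine.
Context {R : realType}.

#[export] Instance ae_lebesgue_filter :
  Filter (nbhs (almost_everywhere (@lebesgue_measure R))).
Proof. exact: ae_filter_ringOfSetsType. Qed.

(** The pushforward of Lebesgue measure under [a * x + b], scaled by [|a|], gives half-open
    intervals their length, so it is Lebesgue measure itself. Hence preimages of null sets are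
    null. *)
Lemma ae_affine1 (a b : R) (P : R -> Prop) : a != 0 ->
  {ae @lebesgue_measure R, forall x, P x} ->
  {ae @lebesgue_measure R, forall x, P (a * x + b)}.
Proof.
move=> a0 [A [mA A0 PA]].
pose f : measurableTypeR R -> measurableTypeR R := fun x => a * x + b.
have mf : measurable_fun setT f.
  by apply: measurable_funD => //; apply: measurable_funM.
have mfA : measurable (f @^-1` A) by exact: measurable_preimageT.
exists (f @^-1` A); split => //; last by move=> x; exact: PA.
pose q : {measure set (measurableTypeR R) -> \bar R} :=
  mscale (NngNum (normr_ge0 a))
    (measure_function_pushforward__canonical__measure_function_Measure
      (@lebesgue_measure R) mf).
have q_itv c d : q `]c, d]%classic = @lebesgue_measure R `]c, d]%classic.
  rewrite /q /= /mscale/= /pushforward lebesgue_measure_itv/= lte_fin.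
  (* For negative [a] the preimage of a left-open interval is right-open, so the two signs are
     treated apart. *)
  move: a0; rewrite neq_lt => /orP[a0|a0].
    rewrite (_ : f @^-1` _ = `[(d - b) / a, (c - b) / a[%classic); last first.
      apply/seteqP; split=> x; rewrite /= !in_itv/= /f ler_ndivrMr// ltr_ndivlMr// mulrC.
        by lra.
      by lra.
    rewrite lebesgue_measure_itv/= lte_fin ltr_ndivrMr// mulfVK ?lt_eqF//.
    rewrite ltrD2r; case: ltP => cd; last by rewrite mule0.
    rewrite -!EFinB -EFinM ltr0_norm//; congr EFin.
    by field; rewrite lt_eqF.
  rewrite (_ : f @^-1` _ = `](c - b) / a, (d - b) / a]%classic); last first.
    apply/seteqP; split=> x; rewrite /= !in_itv/= /f ler_pdivlMr// ltr_pdivrMr// mulrC.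
      by lra.
    by lra.
  rewrite lebesgue_measure_itv/= lte_fin ltr_pdivrMr// mulfVK ?gt_eqF//.
  rewrite ltrD2r; case: ltP => cd; last by rewrite mule0.
  rewrite -!EFinB -EFinM gtr0_norm//; congr EFin.
  by field; rewrite gt_eqF.
have qA : q A = @lebesgue_measure R A.
  by apply/esym/lebesgue_measure_unique => // _ [[c d] _ <-]; rewrite -q_itv.
have : q A = 0%E := etrans qA A0.
rewrite /q/= /mscale/= => /eqP; rewrite mule_eq0 eqe normr_eq0 (negPf a0)/=.
by move=> /eqP.
Qed.

Lemma measurable_dot d (T : measurableType d) n (f g : T -> 'rV[R]_n) :
  measurable_fun setT f -> measurable_fun setT g ->
  measurable_fun setT (fun t => dot (f t) (g t)).
Proof.
move=> /measurable_fun_rVP mf /measurable_fun_rVP mg.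
apply: measurable_sum => i; exact: measurable_funM.
Qed.

Lemma measurable_scale_rV d (T : measurableType d) n (a : T -> R) (f : T -> 'rV[R]_n) :
  measurable_fun setT a -> measurable_fun setT f ->
  measurable_fun setT (fun t => a t *: f t).
Proof.
move=> ma /measurable_fun_rVP mf; apply/measurable_fun_rVP => i.
under eq_fun do rewrite mxE; exact: measurable_funM.
Qed.

Lemma measurable_add_rV d (T : measurableType d) n (f g : T -> 'rV[R]_n) :
  measurable_fun setT f -> measurable_fun setT g ->
  measurable_fun setT (fun t => f t + g t).
Proof.
move=> /measurable_fun_rVP mf /measurable_fun_rVP mg; apply/measurable_fun_rVP => i.
under eq_fun do rewrite mxE; exact: measurable_funD.
Qed.

Lemma measurable_opp_rV d (T : measurableType d) n (f : T -> 'rV[R]_n) :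
  measurable_fun setT f -> measurable_fun setT (fun t => - f t).
Proof.
move=> /measurable_fun_rVP mf; apply/measurable_fun_rVP => i.
under eq_fun do rewrite mxE; exact: measurable_funN.
Qed.

End affine.

Ltac measurability :=
  repeat first
  [ exact: measurable_cst | exact: measurable_id | exact: measurable_fst | exact: measurable_snd
  | assumption
  | apply: measurable_funB | apply: measurable_funD | apply: measurable_funM
  | apply: measurable_funN | apply: measurable_dot | apply: measurable_scale_rV
  | apply: measurable_add_rV | apply: measurable_opp_rV
  | apply: measurable_fun_cons_rV | apply: measurable_fun_pair
  | exact: (measurableT_comp measurable_fst) | exact: (measurableT_comp measurable_snd)
  | apply: (measurableT_comp measurable_fst) | apply: (measurableT_comp measurable_snd)].

Arguments lebesgue_rV : simpl never.

Section affine_rV.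
Context {R : realType}.
Local Notation RR := (measurableTypeR R).

Lemma scale_cons_rV n (a t : R) (x : 'rV[R]_n) :
  a *: cons_rV (t, x) = cons_rV (a * t, a *: x).
Proof.
apply/rowP => j; rewrite mxE; case: (unliftP ord0 j) => [k|] ->.
  by rewrite !cons_rV_ES mxE.
by rewrite !cons_rV_E0.
Qed.

Lemma add_cons_rV n (s t : R) (x y : 'rV[R]_n) :
  cons_rV (s, x) + cons_rV (t, y) = cons_rV (s + t, x + y).
Proof.
apply/rowP => j; rewrite mxE; case: (unliftP ord0 j) => [k|] ->.
  by rewrite !cons_rV_ES mxE.
by rewrite !cons_rV_E0.
Qed.

Lemma dot_cons_rV n (s t : R) (x y : 'rV[R]_n) :
  dot (cons_rV (s, x)) (cons_rV (t, y)) = s * t + dot x y.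
Proof.
rewrite /dot big_ord_recl !cons_rV_E0; congr (_ + _).
by apply: eq_bigr => i _; rewrite !cons_rV_ES.
Qed.

(** For a [P] that may be nonmeasurable, Tonelli is applied to a measurable null set containing the
    complement of [P]. *)
Lemma ae_lebesgue_rVS_section n (P : 'rV[R]_n.+1 -> Prop) :
  {ae @lebesgue_rV R n.+1, forall x, P x} ->
  {ae @lebesgue_measure R, forall t, {ae @lebesgue_rV R n,
    forall x, P (cons_rV (t, x))}}.
Proof.
move=> [A [mA A0 PA]]; move/ae_notP/ae_lebesgue_rVS : A0 => /(_ mA mA).
apply: filterS => t; apply: filterS => x; apply: contra_notP => Px.
exact: PA.
Qed.

(** Induction on the dimension: the first coordinate is handled by [ae_affine1], the others by the
    induction hypothesis on each slice. *)
Lemma ae_affine n (a : R) (b : 'rV[R]_n) (P : 'rV[R]_n -> Prop) : a != 0 ->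
  {ae @lebesgue_rV R n, forall x, P x} ->
  {ae @lebesgue_rV R n, forall x, P (a *: x + b)}.
Proof.
move=> a0; elim: n => [|n IH] in b P *.
  apply: filterS => x.
  by rewrite [X in P X -> _](_ : _ = a *: x + b)//; apply/rowP => -[].
move=> [A [mA A0 PA]].
have {}A0 : {ae @lebesgue_rV R n.+1, forall x, ~ A (a *: x + b)}.
  apply/(@ae_lebesgue_rVS _ _ ((fun x => a *: x + b) @^-1` A)).
    by apply: measurable_preimageT => //; measurability.
  move/ae_notP/ae_lebesgue_rVS : A0 => /(_ mA mA) A0.
  have {A0} := ae_affine1 (b ord0 ord0) a0 A0.
  apply: filterS => t /(IH (uncons_rV b).2); apply: filterS => x.
  by rewrite /= -[X in A (_ + X)]uncons_rVK scale_cons_rV add_cons_rV.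
by apply: filterS A0 => x; apply: contra_notP => Px; exact: PA.
Qed.

End affine_rV.

(** * From null sets on almost every hyperplane to null sets in space *)

Lemma ae_swap3 d1 d2 d3 (T1 : measurableType d1) (T2 : measurableType d2)
    (T3 : measurableType d3) (R : realType)
    (m1 : {sigma_finite_measure set T1 -> \bar R})
    (m2 : {sigma_finite_measure set T2 -> \bar R})
    (m3 : {sigma_finite_measure set T3 -> \bar R}) (E : set (T1 * T2 * T3)) :
  measurable E ->
  {ae m1, forall x, {ae m2, forall y, {ae m3, forall z, ~ E (x, y, z)}}} ->
  {ae m2, forall y, {ae m1, forall x, {ae m3, forall z, ~ E (x, y, z)}}}.
Proof.
(* Absorbing the innermost quantifier into the measurable set [N] of pairs with a non-null section
   reduces the claim to [ae_swap]. *)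
move=> mE; pose N := [set p | m3 (xsection E p) != 0%E].
have mN : measurable N.
  rewrite -[N]setTI; apply: emeasurable_neq => //; exact: measurable_fun_xsection.
have NE p : ~ N p <-> {ae m3, forall z, ~ E (p, z)}.
  rewrite /N/=; have mEp : measurable (xsection E p) by exact: measurable_xsection.
  split=> [/negP/negPn/eqP/(ae_notP _ mEp)|aeE].
    by apply: filterS => z; rewrite /xsection/= inE.
  apply/negP/negPn/eqP/ae_notP => //.
  by apply: filterS aeE => z; rewrite /xsection/= inE.
move=> H; have : {ae m2, forall y, {ae m1, forall x, ~ N (x, y)}}.
  apply: ae_swap => //; apply: filterS H => x; apply: filterS => y.
  by move=> /NE.
by apply: filterS => y; apply: filterS => x /NE.
Qed.

Section cut.
Context {R : realType}.
Local Notation RR := (measurableTypeR R).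

Lemma ae_lebesgue_ex (P : R -> Prop) : {ae @lebesgue_measure R, forall x, P x} ->
  exists2 x, 0 <= x <= 1 & P x.
Proof.
move=> [A [mA A0 PA]]; apply: contrapT => nP.
have : (@lebesgue_measure R `[0%R, 1%R]%classic <= lebesgue_measure A)%E.
  apply: le_measure; rewrite ?inE//.
  move=> x /=; rewrite in_itv/= => x01; apply: PA => /= Px.
  by apply: nP; exists x.
by rewrite A0 lebesgue_measure_itv/= lte_fin ltr01 oppr0 adde0 lee_fin ler10.
Qed.

Lemma ae_lebesgue_rV0 (P : 'rV[R]_0 -> Prop) :
  {ae @lebesgue_rV R 0, forall x, P x} -> P 0.
Proof.
move=> [A [mA A0 PA]]; apply: contrapT => nP.
move: A0; rewrite [LHS]diracE mem_set//; last exact: (PA _ nP).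
by move/eqP; rewrite eqe oner_eq0.
Qed.

Lemma ae_lebesgue_neq (a : R) : {ae @lebesgue_measure R, forall x, x != a}.
Proof.
exists [set a]; split => //; first exact: lebesgue_measure_set1.
by move=> x /= /negP/negPn/eqP.
Qed.

(** Induction on the dimension: if the tail of [c] is nonzero, every slice is a hyperplane of lower
    dimension; otherwise only the slice [t = b / c0] meets the hyperplane. *)
Lemma ae_hyperplane n (c : 'rV[R]_n) (b : R) : c != 0 ->
  {ae @lebesgue_rV R n, forall x, dot c x != b}.
Proof.
elim: n => [|n IH] in c b *.
  by move=> /eqP; case; apply/rowP => -[].
move=> c0.
suff : {ae @lebesgue_rV R n.+1, forall x, ~ [set x | dot c x = b] x}.
  by apply: filterS => x /= /eqP.
apply/ae_lebesgue_rVS.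
  apply: (measurable_preimageT (A := [set b])) => //; measurability.
move: c0; rewrite -(uncons_rVK c); case: (uncons_rV c) => c0 c' cn0.
have [c'0|c'0] := eqVneq c' 0; last first.
  apply: filterE => t.
  have := IH c' (b - c0 * t) c'0.
  apply: filterS => x /eqP h /=; rewrite dot_cons_rV => e; apply: h.
  by rewrite -e addrC addKr.
have {}cn0 : c0 != 0.
  apply: contra_neq cn0 => ->; rewrite c'0; apply/rowP => j; rewrite [RHS]mxE.
  by case: (unliftP ord0 j) => [k|] ->; rewrite ?cons_rV_ES ?cons_rV_E0 /= ?mxE.
apply: filterS (ae_lebesgue_neq (b / c0)) => t tb.
apply: filterE => x /=; rewrite dot_cons_rV c'0.
rewrite /dot big1 => [|i _]; last by rewrite mxE mul0r.
by rewrite addr0 => e; move/eqP: tb; apply; rewrite -e mulrC mulKf.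
Qed.

(* The minor uses the last two coordinates because the induction peels off
   coordinates from the front. *)
Lemma ae_dot_pair k (x y : 'rV[R]_k.+2) (i j : 'I_k.+2) (S T : set RR) (c d : R) :
  i = k :> nat -> j = k.+1 :> nat ->
  x ord0 j != 0 -> x ord0 i * y ord0 j - x ord0 j * y ord0 i != 0 ->
  measurable S -> measurable T ->
  {ae @lebesgue_rV R k.+2, forall w, ~ (S (dot w x + c) /\ T (dot w y + d))} ->
  {ae @lebesgue_measure R, forall s, ~ S s} \/ {ae @lebesgue_measure R, forall t, ~ T t}.
Proof.
elim: k => [|k IH] in x y i j c d *; move=> ik jk xj0 D mS mT; last first.
  (* One good value [t] of the first coordinate of [w] is fixed; its contributions [t * x0] and
     [t * y0] go into the shifts [c] and [d], which are there for this induction. *)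
  move=> /ae_lebesgue_rVS_section/ae_lebesgue_ex[t _].
  have lk (l : 'I_k.+2) (l' : 'I_k.+3) : l' = l.+1 :> nat -> l' = lift ord0 l.
    by move=> e; apply/val_inj; rewrite /= /bump/= e.
  have ki : (k < k.+2)%N by rewrite ltnS leqnSn.
  have kj : (k.+1 < k.+2)%N by rewrite ltnSn.
  have ei := lk (Ordinal ki) i ik; have ej := lk (Ordinal kj) j jk.
  rewrite -(uncons_rVK x) -(uncons_rVK y) in xj0 D *.
  move: (uncons_rV x) (uncons_rV y) xj0 D => [x0 x'] [y0 y'].
  rewrite ei ej !cons_rV_ES/= => xj0 D H.
  apply: (IH x' y' (Ordinal ki) (Ordinal kj) (t * x0 + c) (t * y0 + d)) => //.
  apply: filterS H => w; rewrite !dot_cons_rV.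
  by rewrite addrAC [in X in T X]addrAC [_ + dot w x']addrC [_ + dot w y']addrC.
move=> /ae_lebesgue_rVS_section.
pose x1 := x ord0 i; pose x2 := x ord0 j.
pose y1 := y ord0 i; pose y2 := y ord0 j.
have ei : i = ord0 by apply/val_inj.
have ej : j = lift ord0 ord0 by apply/val_inj.
have dotE t1 t2 (z : 'rV[R]_2) : dot (cons_rV (t1, cons_rV (t2, 0 : 'rV[R]_0))) z
    = t1 * z ord0 i + t2 * z ord0 j.
  by rewrite /dot !big_ord_recl big_ord0 ei ej cons_rV_E0 cons_rV_ES cons_rV_E0 addr0.
move=> H0.
have {H0} : {ae @lebesgue_measure R, forall t1, {ae @lebesgue_measure R, forall t2,
    ~ (S (t1 * x1 + t2 * x2 + c) /\ T (t1 * y1 + t2 * y2 + d))}}.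
  apply: filterS H0 => t1 /ae_lebesgue_rVS_section; apply: filterS => t2.
  by move/ae_lebesgue_rV0; rewrite !dotE.
move=> H.
(* The variable [t2] is traded for [s = t1 * x1 + t2 * x2 + c], the argument of [S]. The argument of
   [T] becomes affine in [t1], with slope [y1 - x1 * y2 / x2]. *)
pose E : set (RR * RR) := [set p | S p.2 /\
  T (p.1 * (y1 - x1 * y2 / x2) + ((p.2 - c) * (y2 / x2) + d))].
have {H} : {ae @lebesgue_measure R, forall t1, {ae @lebesgue_measure R, forall s, ~ E (t1, s)}}.
  apply: filterS H => t1 H.
  have := ae_affine1 (- (t1 * x1 + c) / x2) (invr_neq0 xj0) H.
  apply: filterS => s; rewrite /E/= -/x2.
  set u := (X in S X); set v := (X in T X); set v' := (X in S s /\ T X).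
  have -> : u = s by rewrite /u; field.
  by have -> : v = v' by rewrite /v /v'; field.
move=> /ae_swap aeE.
have {aeE} : {ae @lebesgue_measure R, forall s, {ae @lebesgue_measure R, forall t1, ~ E (t1, s)}}.
  apply: aeE; apply: measurableI.
    by apply: (measurable_preimageT (A := S)) => //; measurability.
  by apply: (measurable_preimageT (A := T)) => //; measurability.
have [aeT _|naeT] := pselect {ae @lebesgue_measure R, forall t, ~ T t}; first by right.
move=> aeE; left; apply: filterS aeE => s aeE Ss; apply: naeT.
(* The minor is [- x2 * e], so [e] is nonzero. A single good [s] in [S] would then make [T] null, by
   an affine substitution in [t1]. *)
set e := y1 - x1 * y2 / x2 in E aeE.
have e0 : e != 0.
  apply: contra_neq D => e0.
  have -> : x ord0 i * y ord0 j - x ord0 j * y ord0 i = - x2 * e.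
    by rewrite /e /x1 /x2 /y1 /y2; field.
  by rewrite e0 mulr0.
have := ae_affine1 (- ((s - c) * (y2 / x2) + d) / e) (invr_neq0 e0) aeE.
apply: filterS => t; rewrite /E/= => h Tt; apply: h; split => //.
set u := (X in T X); suff -> : u = t by [].
by rewrite /u; field; apply/andP.
Qed.

(** This is the exchange of integrals for the graphs [x_1 = <w, x'>]: for almost every pair of base
    points, [ae_dot_pair] makes the fibre of [A] over the first or that of [B] over the second
    null. *)
Lemma ae_cut k (A B : set 'rV[R]_k.+3) : measurable A -> measurable B ->
  {ae @lebesgue_rV R k.+2, forall w,
    {ae @lebesgue_rV R k.+2, forall x, ~ A (cons_rV (dot w x, x))} \/
    {ae @lebesgue_rV R k.+2, forall y, ~ B (cons_rV (dot w y, y))}} ->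
  {ae @lebesgue_rV R k.+3, forall x, ~ A x} \/ {ae @lebesgue_rV R k.+3, forall x, ~ B x}.
Proof.
move=> mA mB H.
pose E : set ('rV[R]_k.+2 * 'rV[R]_k.+2 * 'rV[R]_k.+2) :=
  [set p | A (cons_rV (dot p.1.1 p.1.2, p.1.2)) /\ B (cons_rV (dot p.1.1 p.2, p.2))].
have mE : measurable E.
  apply: measurableI.
    by apply: (measurable_preimageT (A := A)) => //; measurability.
  by apply: (measurable_preimageT (A := B)) => //; measurability.
have {H} : {ae @lebesgue_rV R k.+2, forall w, {ae @lebesgue_rV R k.+2, forall x,
    {ae @lebesgue_rV R k.+2, forall y, ~ E (w, x, y)}}}.
  apply: filterS H => w [Aw|Bw].
    by apply: filterS Aw => x Ax; apply: aeW => y [].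
  by apply: aeW => x; apply: filterS Bw => y By [].
(* Two exchanges bring the quantifiers from the order w, x, y to x, y, w. *)
move=> /(ae_swap3 mE) H.
have {H} : {ae @lebesgue_rV R k.+2, forall x, {ae @lebesgue_rV R k.+2, forall y,
    {ae @lebesgue_rV R k.+2, forall w, ~ E (w, x, y)}}}.
  apply: filterS H => x H.
  apply: (@ae_swap _ _ _ _ _ _ _ [set p | E (p.1, x, p.2)]) => //.
  by apply: (measurable_preimageT (A := E)) => //; measurability.
pose U x := {ae @lebesgue_measure R, forall s, ~ A (cons_rV (s, x))}.
pose V y := {ae @lebesgue_measure R, forall s, ~ B (cons_rV (s, y))}.
have mAx x : measurable ([set s | A (cons_rV (s, x))] : set RR).
  by apply: (measurable_preimageT (A := A)) => //; measurability.
have mBx x : measurable ([set s | B (cons_rV (s, x))] : set RR).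
  by apply: (measurable_preimageT (A := B)) => //; measurability.
have ki : (k < k.+2)%N by rewrite ltnS leqnSn.
have kj : (k.+1 < k.+2)%N by rewrite ltnSn.
pose i := Ordinal ki; pose j := Ordinal kj.
have ij : (i == j) = false by apply/negbTE; rewrite -val_eqE/= ltn_eqF.
move=> H.
have : {ae @lebesgue_rV R k.+2, forall x, {ae @lebesgue_rV R k.+2, forall y, U x \/ V y}}.
  have d0 : (delta_mx 0 j : 'rV[R]_k.+2) != 0.
    by apply/eqP => /rowP/(_ j)/eqP; rewrite !mxE !eqxx oner_eq0.
  have dotd x : dot (delta_mx 0 j : 'rV[R]_k.+2) x = x ord0 j.
    rewrite /dot (bigD1 j)//= big1 => [|l lj]; rewrite !mxE ?eqxx ?mul1r ?addr0//.
    by rewrite (negPf lj) mul0r.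
  apply: filterS2 H (ae_hyperplane 0 d0) => x H; rewrite dotd => xj0.
  (* With this [c], [dot c y] is the minor of [ae_dot_pair]; as [x ord0 j] is nonzero, so is [c],
     and the minor vanishes only on a null set of [y]. *)
  pose c : 'rV[R]_k.+2 := x ord0 i *: delta_mx 0 j - x ord0 j *: delta_mx 0 i.
  have c0 : c != 0.
    apply/eqP => /rowP/(_ i)/eqP.
    by rewrite !mxE !eqxx ij mulr0 mulr1 sub0r oppr_eq0 (negPf xj0).
  have dotc y : dot c y = x ord0 i * y ord0 j - x ord0 j * y ord0 i.
    rewrite /dot (bigD1 i)//= (bigD1 j) ?[j == i]eq_sym ?ij//= big1 => [|l /andP[li lj]].
      by rewrite !mxE !eqxx [j == i]eq_sym ij/=; ring.
    by rewrite !mxE (negPf li) (negPf lj) !andbF/=; ring.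
  apply: filterS2 H (ae_hyperplane 0 c0) => y H; rewrite dotc => D.
  apply: (@ae_dot_pair _ _ _ _ _ [set s | A (cons_rV (s, x))]
    [set s | B (cons_rV (s, y))] 0 0 _ _ xj0 D) => //.
  by apply: filterS H => w; rewrite !addr0.
move=> {}H.
have swap (C : set 'rV[R]_k.+3) : measurable C ->
    {ae @lebesgue_rV R k.+2, forall x, {ae @lebesgue_measure R, forall s, ~ C (cons_rV (s, x))}} ->
    {ae @lebesgue_rV R k.+3, forall x, ~ C x}.
  move=> mC aeC; apply/ae_lebesgue_rVS => //.
  apply: (@ae_swap _ _ _ _ _ _ _ [set p : 'rV[R]_k.+2 * RR | C (cons_rV (p.2, p.1))]) => //.
  by apply: (measurable_preimageT (A := C)) => //; measurability.
(* If [V] does not hold almost everywhere, then [U x] holds at every [x] for which [U x \/ V y]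
   holds for almost every [y]. *)
have [aeV|naeV] := pselect {ae @lebesgue_rV R k.+2, forall y, V y}.
  by right; exact: swap.
left; apply: swap => //; apply: filterS H => x H.
apply: contrapT => nUx; apply: naeV; apply: filterS H => y.
by case=> // /nUx.
Qed.

End cut.

(** * Euclidean norm, cones over subsets of the sphere, and hyperplanes as graphs *)

Section euclidean_norm.
Context {R : realType}.
Implicit Types n : nat.

Lemma dotZl n (a : R) (x y : 'rV[R]_n) : dot (a *: x) y = a * dot x y.
Proof. by rewrite /dot mulr_sumr; apply: eq_bigr => i _; rewrite mxE mulrA. Qed.

Lemma dotC n (x y : 'rV[R]_n) : dot x y = dot y x.
Proof. by apply: eq_bigr => i _; rewrite mulrC. Qed.

Lemma dotDl n (x y z : 'rV[R]_n) : dot (x + y) z = dot x z + dot y z.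
Proof. by rewrite /dot -big_split; apply: eq_bigr => i _; rewrite mxE mulrDl. Qed.

Lemma dot_ge0 n (x : 'rV[R]_n) : 0 <= dot x x.
Proof. by apply: sumr_ge0 => i _; rewrite -expr2 sqr_ge0. Qed.

Lemma sqr_enorm n (x : 'rV[R]_n) : enorm x ^+ 2 = dot x x.
Proof. by rewrite sqr_sqrtr// dot_ge0. Qed.

Lemma enormZ n (a : R) (x : 'rV[R]_n) : enorm (a *: x) = `|a| * enorm x.
Proof. by rewrite /enorm dotZl dotC dotZl mulrA -expr2 sqrtrM ?sqr_ge0// sqrtr_sqr. Qed.

Lemma enormN n (x : 'rV[R]_n) : enorm (- x) = enorm x.
Proof. by rewrite -scaleN1r enormZ normrN1 mul1r. Qed.

Lemma enorm_gt0 n (x : 'rV[R]_n) : (0 < enorm x) = (x != 0).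
Proof.
have [->|] := eqVneq x 0.
  by rewrite -(scale0r (0 : 'rV[R]_n)) enormZ normr0 mul0r ltxx.
apply: contra_neqT; rewrite sqrtr_gt0 -leNgt => dot0; apply/rowP => i; rewrite mxE.
have : dot x x == 0 by rewrite eq_le dot0 dot_ge0.
rewrite psumr_eq0 => [/allP/(_ i)|j _]; last by rewrite -expr2 sqr_ge0.
by rewrite mem_index_enum -expr2 sqrf_eq0 => /(_ isT)/eqP.
Qed.

Lemma enorm_normalize n (x : 'rV[R]_n) : x != 0 -> enorm ((enorm x)^-1 *: x) = 1.
Proof.
by move=> x0; rewrite enormZ ger0_norm ?invr_ge0 ?sqrtr_ge0// mulVf// gt_eqF// enorm_gt0.
Qed.

Lemma measurable_preim_itv d (T : measurableType d) (f : T -> R) (i : interval R) :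
  measurable_fun setT f -> measurable [set x | f x \in i].
Proof.
by move=> mf; apply: (measurable_preimageT (A := [set` i])) => //; exact: measurable_itv.
Qed.

Lemma measurable_enorm n : measurable_fun setT (@enorm R n).
Proof.
rewrite (_ : @enorm R n = fun x => (dot x x) `^ 2^-1); last first.
  by apply/funext => x; rewrite powR12_sqrt// dot_ge0.
have mdot : measurable_fun setT (fun x : 'rV[R]_n => dot x x) by measurability.
exact: (measurableT_comp (measurable_powR 2^-1) mdot).
Qed.

Lemma measurable_normalize n :
  measurable_fun setT (fun x : 'rV[R]_n => (enorm x)^-1 *: x).
Proof.
apply: measurable_scale_rV => //.
under eq_fun do rewrite -powR_inv1 ?sqrtr_ge0//.
exact: (measurableT_comp (measurable_powR (-1)) (@measurable_enorm n)).
Qed.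

Lemma measurable_sphere n : measurable (@sphere R n).
Proof.
rewrite (_ : @sphere R n = @enorm R n @^-1` [set 1])//.
by apply: measurable_preimageT => //; exact: measurable_enorm.
Qed.

(** This is the set whose volume enters [polar_measure]; it turns null sets of the sphere into
    Lebesgue null sets. *)
Definition ball_cone n (A : set 'rV[R]_n) : set 'rV[R]_n :=
  [set x | (0 < enorm x <= 1)%R /\ A ((enorm x)^-1 *: x)].

Lemma measurable_ball_cone n (A : set 'rV[R]_n) :
  measurable A -> measurable (ball_cone A).
Proof.
move=> mA; apply: measurableI; last first.
  exact: measurable_preimageT measurableT (@measurable_normalize n) mA.
by have := measurable_preim_itv `]0, 1] (@measurable_enorm n); under eq_set do rewrite in_itv/=.
Qed.

Lemma polar_measure_eq0 n k (mu : set 'rV[R]_n -> \bar R) (A : set 'rV[R]_n) :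
  (0 < k)%N -> polar_measure k mu A = 0%E <-> mu (ball_cone A) = 0%E.
Proof.
move=> k0; rewrite /polar_measure -/(ball_cone A); split=> [/eqP|->]; last by rewrite mule0.
by rewrite mule_eq0 eqe pnatr_eq0 gtn_eqF//= => /eqP.
Qed.

(** The full cone over [A] is the countable union of the dilates of [ball_cone A] by [k.+1], each
    null by [ae_affine]. *)
Lemma ae_normalize n (A : set 'rV[R]_n) :
  {ae @lebesgue_rV R n, forall x, ~ ball_cone A x} ->
  {ae @lebesgue_rV R n, forall x, x != 0 -> ~ A ((enorm x)^-1 *: x)}.
Proof.
move=> H.
have : {ae @lebesgue_rV R n, forall x, forall k : nat, ~ ball_cone A (k.+1%:R^-1 *: x + 0)}.
  apply: ae_foralln => k; have k0 : k.+1%:R^-1 != 0 :> R by rewrite invr_eq0 pnatr_eq0.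
  exact: (ae_affine 0 k0 H).
(* With [k] the integer part of the norm, [x] divided by [k.+1] lies in the unit ball. *)
apply: filterS => x; set k := Num.trunc (enorm x) => /(_ k); rewrite addr0 => nAx x0 Ax.
apply: nAx; split.
  rewrite enorm_gt0 scaler_eq0 negb_or x0 invr_eq0 pnatr_eq0/=.
  rewrite enormZ ger0_norm ?invr_ge0// mulrC ler_pdivrMr// mul1r.
  exact/ltW/truncnS_gt.
rewrite enormZ ger0_norm ?invr_ge0// invfM invrK scalerA mulrAC.
by rewrite divff// ?mul1r// pnatr_eq0.
Qed.

(* The cylinder over A is sheared onto a product, x = y + s u with y in the
   hyperplane orthogonal to u, seen as a graph over the last coordinates. *)
Lemma ae_hyperplane_graph n (u0 : R) (u' : 'rV[R]_n) (A : set 'rV[R]_n.+1)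
    (u := cons_rV (u0, u')) :
  dot u u = 1 -> u0 != 0 -> measurable A ->
  {ae @lebesgue_rV R n.+1, forall x, ~ ((0 <= dot x u <= 1)%R /\ A (x - dot x u *: u))} ->
  {ae @lebesgue_rV R n, forall y, ~ A (cons_rV (dot (- u0^-1 *: u') y, y))}.
Proof.
move=> u1 u00 mA /ae_lebesgue_rVS_section H.
pose C : set ('rV[R]_n.+1) := [set x | (0 <= dot x u <= 1)%R /\ A (x - dot x u *: u)].
have mC : measurable C.
  apply: measurableI.
    have mf : measurable_fun setT (fun x => dot x u) by measurability.
    by have := measurable_preim_itv `[0, 1] mf; under eq_set do rewrite in_itv/=.
  by apply: (measurable_preimageT (A := A)) => //; measurability.
have {}H : {ae @lebesgue_rV R n, forall y, {ae @lebesgue_measure R, forall t,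
    ~ C (cons_rV (t, y))}}.
  apply: (@ae_swap _ _ _ _ _ _ _
    [set p : measurableTypeR R * 'rV[R]_n | C (cons_rV (p.1, p.2))]) => //.
  by apply: (measurable_preimageT (A := C)) => //; measurability.
(* [D] is [C] with the first coordinate replaced by the height [s = dot x u], an affine function of
   it with slope [u0]. *)
pose D (p : 'rV[R]_n * measurableTypeR R) :=
  (0 <= p.2 <= 1)%R /\ A (cons_rV (u0^-1 * p.2 + - (dot p.1 u') / u0, p.1) - p.2 *: u).
have {}H : {ae @lebesgue_rV R n, forall y, {ae @lebesgue_measure R, forall s, ~ D (y, s)}}.
  apply: filterS H => y H.
  have := ae_affine1 (- (dot y u') / u0) (invr_neq0 u00) H.
  apply: filterS => s; rewrite /C /D/= dot_cons_rV.
  have -> // : (u0^-1 * s + - (dot y u') / u0) * u0 + dot y u' = s by field.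
(* Almost every slice at constant height is null; one is chosen with height in [[0, 1]], where the
   height condition in [D] holds. *)
have /ae_lebesgue_ex[s s01] : {ae @lebesgue_measure R, forall s,
    {ae @lebesgue_rV R n, forall y, ~ D (y, s)}}.
  apply: (@ae_swap _ _ _ _ _ _ _ D) => //.
  apply: measurableI.
    have mf : measurable_fun setT (fun p : 'rV[R]_n * measurableTypeR R => p.2 : R).
      exact: measurable_snd.
    by have := measurable_preim_itv `[0, 1] mf; under eq_set do rewrite in_itv/=.
  by apply: (measurable_preimageT (A := A)) => //; measurability.
(* Shifting [y] by [s *: u'] undoes the subtraction of [s *: u] in the last coordinates; since [u]
   is a unit vector, [s] also cancels from the first one. *)
move=> /(ae_affine (s *: u') (oner_neq0 _)); apply: filterS => y nD Ay; apply: nD.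
split => //=; rewrite scale1r /u.
have -> : cons_rV (u0^-1 * s + - dot (y + s *: u') u' / u0, y + s *: u') - s *: cons_rV (u0, u')
    = cons_rV (dot (- u0^-1 *: u') y, y); last by [].
rewrite -scaleNr scale_cons_rV add_cons_rV scaleNr addrK; congr (cons_rV (_, _)).
move: u1; rewrite /u dot_cons_rV dotDl !dotZl (dotC y) => u1.
have -> : dot u' u' = 1 - u0 * u0 by rewrite -u1 addrAC subrr add0r.
by field.
Qed.

End euclidean_norm.

(** * Null sets of the sphere and of its equators *)

Section sphere_negligible.
Context {R : realType}.

Lemma sphere_measure_eq0P n (A : set 'rV[R]_n.+1) : measurable A ->
  sphere_measure A = 0%E <-> {ae @lebesgue_rV R n.+1, forall x, ~ ball_cone A x}.
Proof.
by move=> mA; rewrite polar_measure_eq0// ae_notP//; exact: measurable_ball_cone.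
Qed.

Lemma measurable_sphere_neq n (f g : 'rV[R]_n -> R) :
  measurable_fun (@sphere R n) f -> measurable_fun (@sphere R n) g ->
  measurable [set x | sphere x /\ f x <> g x].
Proof.
move=> mf mg; have mS := @measurable_sphere R n.
have mY : measurable [set false] by [].
have := measurable_fun_eqr mf mg mS mY.
congr measurable; apply/seteqP; split=> x /= [Sx fg]; split=> //.
  by move=> e; rewrite e eqxx in fg.
exact/eqP.
Qed.

Lemma sphereN n (x : 'rV[R]_n) : sphere (- x) = sphere x.
Proof. by rewrite /sphere/= enormN. Qed.

Lemma cons_rV_neq0 n (t : R) (x : 'rV[R]_n) : t != 0 -> cons_rV (t, x) != 0.
Proof.
apply: contra_neq => tx0; have := cons_rV_E0 (t, x) ord0.
by rewrite tx0 mxE => /= <-.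
Qed.

(* v = (v1, - v1 w) is normal to the graph x_1 = <w, x'>. *)
Lemma ae_equator_graph n (v1 : R) (w : 'rV[R]_n.+1) (v := cons_rV (v1, - v1 *: w))
    (u := (enorm v)^-1 *: v) (A Z : set 'rV[R]_n.+2) :
  v1 != 0 -> measurable A -> measurable Z -> equator_measure u Z = 0%E ->
  (forall x, equator u x -> A x -> Z x) ->
  {ae @lebesgue_rV R n.+1, forall x, ~ ball_cone A (cons_rV (dot w x, x))}.
Proof.
move=> v10 mA mZ Z0 AZ.
have v0 : v != 0 by exact: cons_rV_neq0.
have nv : enorm v != 0 by rewrite gt_eqF// enorm_gt0.
have u1 : dot u u = 1 by rewrite -sqr_enorm enorm_normalize// expr1n.
have uE : u = cons_rV ((enorm v)^-1 * v1, (enorm v)^-1 *: (- v1 *: w)).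
  by rewrite -scale_cons_rV.
(* The normalizing factor and [v1] cancel: the hyperplane depends only on the direction of [v]. *)
have wE : - ((enorm v)^-1 * v1)^-1 *: ((enorm v)^-1 *: (- v1 *: w)) = w.
  by rewrite !scalerA -[RHS]scale1r; congr (_ *: _); field; apply/andP.
rewrite -wE; apply: ae_hyperplane_graph; rewrite -?uE//.
- by rewrite mulf_neq0// invr_eq0.
- exact: measurable_ball_cone.
move: Z0 => /polar_measure_eq0 -/(_ isT) Z0.
pose C (B : set 'rV[R]_n.+2) : set 'rV[R]_n.+2 :=
  [set x | (0 <= dot x u <= 1)%R /\ ball_cone B (x - dot x u *: u)].
have mC : measurable (C Z).
  apply: measurableI.
    have mf : measurable_fun setT (fun x => dot x u) by measurability.
    by have := measurable_preim_itv `[0, 1] mf; under eq_set do rewrite in_itv/=.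
  apply: (measurable_preimageT (A := ball_cone Z)) => //; last exact: measurable_ball_cone.
  by measurability.
move/(ae_notP _ mC) : Z0; apply: filterS => x; apply: contra_not => -[xu [ny Ay]].
(* The normalized projection of [x] along [u] lies on the equator, where [A] is contained in [Z]. *)
split => //; split => //; apply: AZ => //; split.
  by rewrite enorm_normalize// -enorm_gt0; case/andP : ny.
by rewrite dotZl dotDl -scaleNr dotZl u1 mulr1 subrr mulr0.
Qed.

End sphere_negligible.

Theorem mainTheorem10 (R : realType) (n : nat) (hn : (3 <= n)%N)
    (f g : 'rV[R]_n -> R) (hf : L1_sphere f) (hg : L1_sphere g)
    (hfg : {ae @sphere_measure R n, forall u, sphere u ->
       {ae equator_measure u, forall x, equator u x -> f x = g x} \/
       {ae equator_measure u, forall x, equator u x -> f x = g (- x)}}) :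
  {ae @sphere_measure R n, forall x, sphere x -> f x = g x} \/
  {ae @sphere_measure R n, forall x, sphere x -> f x = g (- x)}.
Proof.
(* With [n = k.+3], the parameter [w] has [k.+2] coordinates, at least the two that [ae_dot_pair]
   requires. *)
case: n hn f g hf hg hfg => [|[|[|k]]]// _ f g.
move=> [f0 /measurable_int/measurable_EFinP mf0 [Nf [mNf Nf0 fNf]]].
move=> [g0 /measurable_int/measurable_EFinP mg0 [Ng [mNg Ng0 gNg]]].
move=> [Nu [mNu Nu0 hfg]].
have mS := @measurable_sphere R k.+3.
have mN : measurable_fun setT (fun x : 'rV[R]_k.+3 => - x) by measurability.
have mg0N : measurable_fun (@sphere R k.+3) (fun x => g0 (- x)).
  apply: (measurable_comp (F := @sphere R k.+3) (f := g0)) => //.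
    by move=> _ [x Sx <-]; rewrite sphereN.
  exact: measurable_funTS.
pose NgN : set 'rV[R]_k.+3 := [set x | Ng (- x)].
have mNgN : measurable NgN by apply: (measurable_preimageT (A := Ng)).
have fE x : sphere x -> ~ Nf x -> f x = f0 x.
  by move=> Sx; apply: contra_notP => fx; apply: fNf => /= h; exact/fx/h.
have gE x : sphere x -> ~ Ng x -> g x = g0 x.
  by move=> Sx; apply: contra_notP => gx; apply: gNg => /= h; exact/gx/h.
(* [P] and [Q] are built from the Borel representatives to be measurable; removing the exceptional
   sets ensures that the original functions differ there too. *)
pose P := [set x | sphere x /\ f0 x <> g0 x] `\` (Nf `|` Ng).
pose Q := [set x | sphere x /\ f0 x <> g0 (- x)] `\` (Nf `|` NgN).
have mP : measurable P.
  by apply: measurableD; [exact: measurable_sphere_neq|exact: measurableU].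
have mQ : measurable Q.
  by apply: measurableD; [exact: measurable_sphere_neq|exact: measurableU].
have PE x : P x -> f x <> g x.
  by move=> [[Sx fg]] /not_orP[nf ng]; rewrite fE// gE.
have QE x : Q x -> f x <> g (- x).
  by move=> [[Sx fg]] /not_orP[nf ng]; rewrite fE// gE// sphereN.
have {}Nf0 := (sphere_measure_eq0P mNf).1 Nf0.
have {}Ng0 := (sphere_measure_eq0P mNg).1 Ng0.
have {}Nu0 := (sphere_measure_eq0P mNu).1 Nu0.
(* The antipodal map is the affine substitution with factor -1, so the reflected exceptional set is
   null as well. *)
have NgN0 : {ae @lebesgue_rV R k.+3, forall x, ~ ball_cone NgN x}.
  have N10 : -1 != 0 :> R by rewrite oppr_eq0 oner_eq0.
  have := ae_affine 0 N10 Ng0; apply: filterS => x; apply: contra_not => -[nx Ngx].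
  by rewrite addr0 scaleN1r; split; rewrite enormN// scalerN.
have [AP|AQ] : {ae @lebesgue_rV R k.+3, forall x, ~ ball_cone P x} \/
    {ae @lebesgue_rV R k.+3, forall x, ~ ball_cone Q x}.
- apply: ae_cut; [exact: measurable_ball_cone|exact: measurable_ball_cone|].
  (* Almost every vector has its direction outside [Nu]. A good first coordinate [v1 != 0] is fixed
     and the others are written [- v1 *: w], so almost every [w] gives a good normal [v]. *)
  have /ae_lebesgue_rVS_section H := ae_normalize Nu0.
  have [v1 _ [v10 {}H]] := ae_lebesgue_ex (filterI (ae_lebesgue_neq 0) H).
  have nv10 : - v1 != 0 by rewrite oppr_eq0.
  have := ae_affine 0 nv10 H; apply: filterS => w; rewrite addr0; set v := cons_rV _ => Nv.
  have v0 : v != 0 by exact: cons_rV_neq0.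
  have [] : {ae equator_measure ((enorm v)^-1 *: v),
        forall x, equator ((enorm v)^-1 *: v) x -> f x = g x} \/
      {ae equator_measure ((enorm v)^-1 *: v),
        forall x, equator ((enorm v)^-1 *: v) x -> f x = g (- x)}.
  + apply: contrapT => h; apply: (Nv v0); apply: hfg => /= h'; apply: h; apply: h'.
    exact: enorm_normalize.
  + move=> [Z [mZ Z0 fgZ]]; left; apply: (ae_equator_graph v10 mP mZ Z0) => x ux Px.
    by apply: fgZ => /= h; exact/(PE _ Px)/h.
  + move=> [Z [mZ Z0 fgZ]]; right; apply: (ae_equator_graph v10 mQ mZ Z0) => x ux Qx.
    by apply: fgZ => /= h; exact/(QE _ Qx)/h.
(* Outside [Nf] and [Ng] the functions equal their representatives, so every remaining point of the
   sphere where they differ is in [P]. *)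
- left; exists (P `|` (Nf `|` Ng)); split.
  + by apply: measurableU => //; exact: measurableU.
  + apply/sphere_measure_eq0P; first by apply: measurableU => //; exact: measurableU.
    by apply: filterS3 AP Nf0 Ng0 => x nP nf ng [nx [Px|[Nx|Nx]]];
      [apply: nP|apply: nf|apply: ng].
  + move=> x /= /not_implyP[Sx fg].
    have [Nx|nx] := pselect ((Nf `|` Ng) x); [by right|left; split => //; split => //].
    by move/not_orP : nx => [nf ng]; rewrite -fE// -gE.
- right; exists (Q `|` (Nf `|` NgN)); split.
  + by apply: measurableU => //; exact: measurableU.
  + apply/sphere_measure_eq0P; first by apply: measurableU => //; exact: measurableU.
    by apply: filterS3 AQ Nf0 NgN0 => x nP nf ng [nx [Px|[Nx|Nx]]];
      [apply: nP|apply: nf|apply: ng].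
  + move=> x /= /not_implyP[Sx fg].
    have [Nx|nx] := pselect ((Nf `|` NgN) x); [by right|left; split => //; split => //].
    by move/not_orP : nx => [nf ng]; rewrite -fE// -gE// sphereN.
Qed.
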